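(* Assume that a symmetric Markov semigroup $(T_t)_{t\ge0}$ has a simple generator $L=Id-\mathbb{E}$ or is a tensor product of such simple semigroups. Let $f$ be a strictly positive function on the underlying space. Then for all $q<p\le0$ and $t\ge\log\frac{2-q}{2-p}$, and also for all $0\le q<p<1$ and $t\ge\log\frac{(1-q)(2-p)}{(1-p)(2-q)}$, we have $$\|T_tf\|_q\ge\|f\|_p.$$
   Context: $(\Omega,\mu)$ is a finite probability space with $\mu\{\omega\}>0$ for all $\omega$, and $\mathbb{E}f=\int_\Omega f\,d\mu$. Simple semigroup: $L=Id-\mathbb{E}$, $T_t=e^{-tL}$, i.e. $T_tf=e^{-t}f+(1-e^{-t})\mathbb{E}f$. Tensor product of simple semigroups: given finite probability spaces $(\Omega_i,\mu_i)$, $1\le i\le n$ (all atoms of positive mass), with simple semigroups $T^{(i)}_t=e^{-t(Id-\mathbb{E}_{\mu_i})}$, one takes $(\Omega,\mu)=(\prod_i\Omega_i,\bigotimes_i\mu_i)$ and $T_t=\bigotimes_{i=1}^nT^{(i)}_t$. For strictly positive $f$: $\|f\|_p=(\mathbb{E}f^p)^{1/p}$ for real $p\ne0$, and $\|f\|_0=\exp(\mathbb{E}\log f)$. *)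

(* Defs.v *)
From HB Require Import structures.
From mathcomp Require Import all_boot all_order all_algebra.
From mathcomp Require Import all_classical all_reals all_analysis.
From mathcomp Require Import ring.

Set Implicit Arguments.
Unset Strict Implicit.
Unset Printing Implicit Defensive.
Import Order.TTheory GRing.Theory Num.Theory.
Import numFieldNormedType.Exports.

Local Open Scope ring_scope.

Record finProb (R : realType) := FinProb {
  fp_space :> finType;
  fp_mass : fp_space -> R;
  fp_mass_gt0 : forall w, 0 < fp_mass w;
  fp_mass_sum1 : \sum_(w : fp_space) fp_mass w = 1 }.

Definition expect (R : realType) (X : finProb R) (f : X -> R) : R :=
  \sum_(w : X) fp_mass w * f w.

(* Only meant for strictly positive [f], where [powR] and [ln] have their usual
   meaning. *)
Definition pnorm (R : realType) (X : finProb R) (p : R) (f : X -> R) : R :=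
  if p == 0 then expR (expect (fun w => ln (f w)))
  else (expect (fun w => f w `^ p)) `^ p^-1.

Definition simple_generator (R : realType) (X : finProb R) (f : X -> R) : X -> R :=
  fun w => f w - expect f.

(* The closed form of exp (- t L) for L = simple_generator X: since L is
   idempotent, exp (- t L) = Id + (e^{-t} - 1) L.  See [simple_semigroup_ode]. *)
Definition simple_semigroup (R : realType) (X : finProb R) (t : R)
    (f : X -> R) : X -> R :=
  fun w => expR (- t) * f w + (1 - expR (- t)) * expect f.

Section SimpleSemigroupFacts.
Variables (R : realType) (X : finProb R).

Lemma expect_affine (a b : R) (f : X -> R) :
  expect (fun w => a * f w + b) = a * expect f + b.
Proof.
rewrite /expect; under eq_bigr do rewrite mulrDr mulrCA.
by rewrite big_split /= -mulr_sumr -mulr_suml fp_mass_sum1 mul1r.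
Qed.

Lemma simple_semigroup0 (f : X -> R) : simple_semigroup 0 f = f.
Proof.
by apply/funext => w; rewrite /simple_semigroup oppr0 expR0 subrr mul0r mul1r addr0.
Qed.

Lemma simple_semigroupD (s t : R) (f : X -> R) :
  simple_semigroup (s + t) f = simple_semigroup s (simple_semigroup t f).
Proof.
apply/funext => w; rewrite /simple_semigroup expect_affine opprD expRD.
by ring.
Qed.

Lemma simple_semigroup_ode (t : R) (f : X -> R) (w : X) :
  is_derive t 1 (fun s => simple_semigroup s f w)
    (- simple_generator (simple_semigroup t f) w).
Proof.
rewrite /simple_generator /simple_semigroup expect_affine.
apply: is_derive_eq; rewrite /GRing.scale /=.
by ring.
Qed.

End SimpleSemigroupFacts.

Section Product.
Variables (R : realType) (n : nat) (X : 'I_n -> finProb R).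

Lemma sum_dffun_prod (g : forall i, X i -> R) :
  \sum_(x : {dffun forall i, X i}) \prod_i g i (x i) = \prod_i \sum_(z : X i) g i z.
Proof.
rewrite (reindex (@dffun_of_fprod _ (fun i => fp_space (X i)))) /=; last first.
  exact/onW_bij/dffun_of_fprod_bij.
pose P i := [ffun z : X i => g i z].
transitivity (\sum_(t : fprod (fun i => fp_space (X i))) \prod_(i in 'I_n) P i (t i)).
  by apply: eq_bigr => t _; apply: eq_bigr => i _; rewrite /P !ffunE.
rewrite big_fprod.
rewrite -(bigA_distr_big_dep (tagged_with (fun i => fp_space (X i)))
  (fun i u => untag 0 (P i) u)).
apply: eq_bigr => i _; rewrite -(@big_tag R 0 +%R _ _ (fun i => P i) i).
by apply: eq_bigr => z _; rewrite ffunE.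
Qed.

Definition prod_mass (x : {dffun forall i, X i}) : R := \prod_i fp_mass (x i).

Lemma prod_mass_gt0 x : 0 < prod_mass x.
Proof. by apply: prodr_gt0 => i _; exact: fp_mass_gt0. Qed.

Lemma prod_mass_sum1 : \sum_x prod_mass x = 1.
Proof.
rewrite /prod_mass (sum_dffun_prod (fun i => @fp_mass R (X i))).
by apply: big1 => i _; exact: fp_mass_sum1.
Qed.

Definition prod_finProb : finProb R := FinProb prod_mass_gt0 prod_mass_sum1.

(* The tensor product of linear operators [A i], given by its matrix in the
   basis of tensor products of indicators of points. *)
Definition tensor_op (A : forall i, (X i -> R) -> X i -> R)
    (f : prod_finProb -> R) : prod_finProb -> R :=
  fun x => \sum_(y : prod_finProb)
    f y * \prod_i A i (fun z => (z == y i)%:R) (x i).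

Lemma tensor_op_prod (A : forall i, (X i -> R) -> X i -> R)
    (g : forall i, X i -> R) (x : prod_finProb) :
  (forall i h z, A i h z = \sum_(u : X i) h u * A i (fun v => (v == u)%:R) z) ->
  tensor_op A (fun y => \prod_i g i (y i)) x = \prod_i A i (g i) (x i).
Proof.
move=> linA; rewrite /tensor_op /=.
under eq_bigr do rewrite -big_split /=.
rewrite (sum_dffun_prod (fun i u => g i u * A i (fun v => (v == u)%:R) (x i))).
by apply: eq_bigr => i _; rewrite -linA.
Qed.

Definition tensor_semigroup (T : forall i, R -> (X i -> R) -> X i -> R)
    (t : R) : (prod_finProb -> R) -> prod_finProb -> R :=
  tensor_op (fun i => T i t).

End Product.

Inductive simple_or_tensor (R : realType) :
    forall X : finProb R, (R -> (X -> R) -> X -> R) -> Prop :=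
| IsSimple (X : finProb R) : simple_or_tensor (@simple_semigroup R X)
| IsTensor (n : nat) (X : 'I_n -> finProb R) : (0 < n)%N ->
    simple_or_tensor (tensor_semigroup (fun i => @simple_semigroup R (X i))).

(* Main.v *)
Require Import Defs.
From mathcomp Require Import all_boot all_order all_algebra.
From mathcomp Require Import all_classical all_reals all_analysis.
From mathcomp Require Import ring lra.
Import Order.TTheory GRing.Theory Num.Theory.
Import numFieldNormedType.Exports.
Set Implicit Arguments.
Unset Strict Implicit.
Unset Printing Implicit Defensive.
Local Open Scope ring_scope.

(** The proof has two halves: a differential inequality for the simple
    semigroup, and a tensorization argument that reduces everything to it.

    Simple semigroup.  By homogeneity let E f = 1.  The exponent is moved from
    [p] down to [q] while time runs from 0 to [t]: with [theta p = 0],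
    [theta q = t] and g_r = T_(theta r) f, the claim is that
    W r = r^-1 ln E (g_r ^ r) = ln ||g_r||_r does not increase in r.  With
    kappa = - theta', its derivative has the sign of
       Ent (g^r) - kappa r^2 (E g^(r-1) E g - E g^r),
    so that a log-Sobolev type inequality for the form of L = Id - E, at every
    exponent r, is enough.  Since E g = 1 the entropy is at most
    E (g^r ln g^r - g^r + 1), and the term E (g - 1) = 0 can be added for free:
    the inequality then holds pointwise in g.  That pointwise inequality is
    [pointwise_entropy_bound]; at g = 1 both sides vanish to second order.  It
    holds with kappa = 1 / (2 - r) for r <= 0 and
    kappa = 1 / ((1 - r) (2 - r)) for 0 <= r < 1, and integrating these two
    rates over [q, p] gives exactly the two thresholds on [t].  Larger times
    correspond to adding a positive constant to kappa ([simple_flow_time]).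
    The flow divides by r, so the endpoints p = 0 and q = 0 are reached by a
    limit ([le_expect_of_log_mgf]).

    Tensor products.  For p < 1 the functional ||.||_p is concave, being the
    lower envelope of linear functionals with nonnegative density
    ([pnorm_supporting_functional]).  A positive operator acting on one
    coordinate can therefore be pulled out of a norm taken over the other
    coordinates, so the estimate for two factors gives the one for their
    product ([rhc_kernel_product]); the general case follows by splitting off
    one coordinate at a time. *)

(** * Scalar inequalities *)

Lemma is_derive_ge0_le (R : realType) (F dF : R -> R) (a b : R) : a <= b ->
  (forall x, a <= x <= b -> is_derive x 1 F (dF x)) ->
  (forall x, a <= x <= b -> 0 <= dF x) -> F a <= F b.
Proof.
move=> ab FdF dF0.
have [x| |c] := @MVT_segment R F dF a b ab.
- by rewrite in_itv => /= /andP[ax xb]; apply: FdF; rewrite !ltW.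
- apply: derivable_within_continuous => x; rewrite in_itv /= => xab.
  by have [] := FdF x xab.
rewrite in_itv => /= cab Fab.
by rewrite -subr_ge0 Fab mulr_ge0 ?dF0 ?subr_ge0.
Qed.

(** A second-derivative test in factored form: [k] is nondecreasing and vanishes
    at 0, so [F'] has the sign of [y] and [F] is minimal at 0. *)
Lemma ge0_of_derive_sign (R : realType) (F e k dk : R -> R) :
  F 0 = 0 -> k 0 = 0 -> (forall y, 0 <= e y) ->
  (forall y : R, is_derive y 1 F (e y * k y)) ->
  (forall y : R, is_derive y 1 k (dk y)) -> (forall y, 0 <= dk y) ->
  forall y, 0 <= F y.
Proof.
move=> F0 k0 e0 dF Dk dk0 y.
have kmono (a b : R) : a <= b -> k a <= k b.
  by move=> ab; apply: (is_derive_ge0_le ab (dF := dk)).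
have [y0|/ltW y0] := leP 0 y.
- rewrite -F0; apply: (is_derive_ge0_le y0 (dF := fun y => e y * k y)) => // x.
  by case/andP=> x0 _; rewrite mulr_ge0 // -k0 kmono.
suff: - F y <= - F 0 by rewrite F0 oppr0 oppr_le0.
apply: (is_derive_ge0_le y0 (F := fun y => - F y) (dF := fun y => - (e y * k y))).
move=> x /andP[_ x0].
by rewrite oppr_ge0 mulr_ge0_le0 // -k0 kmono.
Qed.

(** The weighted arithmetic-geometric inequality for exp (- y) with weight [m] and
    exp (m y) with weight 1, whose weighted product is 1. *)
Lemma amgm_expR (R : realType) (m y : R) : 0 <= m ->
  m + 1 <= m * expR (- y) + expR (m * y).
Proof.
move=> m0; have := expR_ge1Dx (m * y).
have : m * (1 - y) <= m * expR (- y) by rewrite ler_wpM2l // expR_ge1Dx.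
lra.
Qed.

(** Written in y = ln x, the difference of the two sides has derivative
    r^2 x^r k(y), and k' = kappa (1 - r) (exp (- y) + exp ((1 - r) y)) - 1 is
    nonnegative by [amgm_expR] with m = 1 - r.  The two hypotheses on [kappa]
    are what remains of that bound when m >= 1 and when m <= 1. *)
Lemma pointwise_entropy_bound (R : realType) (r kappa y : R) :
  r < 1 -> 1 <= kappa * (2 - r) -> 1 <= kappa * ((1 - r) * (2 - r)) ->
  expR (r * y) * (r * y) - expR (r * y) + 1 <=
  kappa * r ^+ 2 * (expR ((r - 1) * y) - expR (r * y) + expR y - 1).
Proof.
move=> r1 k1 k2; rewrite -subr_ge0.
have k0 : 0 <= kappa by nra.
have m0 : 0 <= 1 - r by lra.
pose k z := kappa * (- (1 - r) * expR (- z) - r + expR ((1 - r) * z)) - z.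
pose dk z := kappa * ((1 - r) * expR (- z) + (1 - r) * expR ((1 - r) * z)) - 1.
pose e z := r ^+ 2 * expR (r * z).
pose F z := kappa * r ^+ 2 * (expR ((r - 1) * z) - expR (r * z) + expR z - 1) -
  (expR (r * z) * (r * z) - expR (r * z) + 1).
apply: (@ge0_of_derive_sign R F e k dk).
- by rewrite /F !mulr0 expR0; ring.
- by rewrite /k !mulr0 oppr0 expR0; ring.
- by move=> z; rewrite mulr_ge0 ?sqr_ge0 ?expR_ge0.
- move=> z; apply: is_derive_eq; rewrite /e /k /GRing.scale /=.
  have E1 : expR ((r - 1) * z) = expR (r * z) * expR (- z).
    by rewrite -expRD; congr expR; ring.
  have E2 : expR (r * z) * expR ((1 - r) * z) = expR z.
    by rewrite -expRD; congr expR; ring.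
  rewrite E1 -E2; ring.
- move=> z; apply: is_derive_eq; rewrite /dk /GRing.scale /=; ring.
move=> z; rewrite /dk.
have := amgm_expR z m0.
have := expR_gt0 (- z); have := expR_gt0 ((1 - r) * z).
set A := expR _; set B := expR _ => A0 B0 AB.
(* m exp (- y) + exp (m y) is at most m (exp (- y) + exp (m y)) if m >= 1, and
   at most exp (- y) + exp (m y) if m <= 1. *)
have [r0|r0] := leP r 0.
  have H : 2 - r <= (1 - r) * B + (1 - r) * A by nra.
  by have := ler_wpM2l k0 H; lra.
have H : (1 - r) * (2 - r) <= (1 - r) * B + (1 - r) * A.
  by rewrite -mulrDr ler_wpM2l //; nra.
by have := ler_wpM2l k0 H; lra.
Qed.

(** The concave function x |-> (x^p - 1) / p lies below its tangent at
    x = 1; here x = exp y. *)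
Lemma box_cox_le (R : realType) (p y : R) : p < 1 -> p != 0 ->
  (expR (p * y) - 1) / p <= expR y - 1.
Proof.
move=> p1 p0; have [pneg|ppos|] := ltgtP p 0; last by move/eqP; rewrite (negPf p0).
  rewrite ler_ndivrMr //.
  have H1 := expR_ge1Dx (p * y).
  by have := ler_wnM2l (ltW pneg) (expR_ge1Dx y); lra.
rewrite ler_pdivrMr //.
have E : expR y = expR (p * y) * expR ((1 - p) * y) by rewrite -expRD; congr expR; ring.
have H : expR (p * y) * expR (- (p * y)) = 1 by rewrite -expRD subrr expR0.
have A0 := expR_gt0 (p * y); have A1 := expR_ge1Dx (- (p * y)).
have A2 := expR_ge1Dx ((1 - p) * y).
move: A0 A1 A2 H; rewrite {}E.
move: (expR (p * y)) (expR (- (p * y))) (expR ((1 - p) * y)) => A B C A0 A1 A2 H.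
have K1 : p * (1 + (1 - p) * y) <= p * C by rewrite ler_pM2l.
have K2 : (1 - p) * (1 + - (p * y)) <= (1 - p) * B by rewrite ler_pM2l // subr_gt0.
have key : 1 - B <= (C - B) * p by lra.
have := ler_wpM2l (ltW A0) key.
by rewrite mulrBr mulr1 mulrA mulrBr H.
Qed.

Lemma x_ln_x_ge (R : realType) (x : R) : 0 < x -> x - 1 <= x * ln x.
Proof.
move=> x0; have := expR_ge1Dx (- ln x); rewrite expRN lnK ?posrE //.
by rewrite -(ler_pM2l x0) mulfV ?gt_eqF //; lra.
Qed.

(** * Expectations and power means *)

Section Expectation.
Variables (R : realType) (X : finProb R).
Implicit Types (f g F : X -> R).

Lemma expectD f g : expect (fun w => f w + g w) = expect f + expect g.
Proof. by rewrite /expect -big_split; apply: eq_bigr => w _; rewrite mulrDr. Qed.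

Lemma expectZ c f : expect (fun w => c * f w) = c * expect f.
Proof. by rewrite /expect mulr_sumr; apply: eq_bigr => w _; rewrite mulrCA. Qed.

Lemma expect_cst c : expect (fun _ : X => c) = c.
Proof. by rewrite /expect -mulr_suml fp_mass_sum1 mul1r. Qed.

Lemma expect_lin c f g F :
  expect (fun w => F w + c * (f w - g w)) = expect F + c * (expect f - expect g).
Proof.
rewrite /expect -sumrB mulr_sumr -big_split; apply: eq_bigr => w _ /=.
by ring.
Qed.

Lemma le_expect f g : (forall w, f w <= g w) -> expect f <= expect g.
Proof.
by move=> fg; apply: ler_sum => w _; rewrite ler_wpM2l // ltW // fp_mass_gt0.
Qed.

Lemma expect_gt0 f : (forall w, 0 < f w) -> 0 < expect f.
Proof.
move=> f0; have mf0 w : 0 <= fp_mass w * f w by rewrite mulr_ge0 // ltW // fp_mass_gt0.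
rewrite lt_neqAle sumr_ge0 // andbT eq_sym; apply/negP => /eqP /psumr_eq0P E0.
have /esym/eqP := @fp_mass_sum1 R X; rewrite big1 ?oner_eq0 // => w _.
have /eqP := E0 (fun w _ => mf0 w) w isT.
by rewrite mulf_eq0 (gt_eqF (f0 w)) orbF => /eqP.
Qed.

End Expectation.

Section PowerMeans.
Variables (R : realType) (X : finProb R).
Implicit Types (f g F : X -> R).

Lemma eq_pnorm p f g : f =1 g -> pnorm p f = pnorm p g.
Proof. by move=> /funext->. Qed.

Lemma pnorm0E f : pnorm 0 f = expR (expect (fun w => ln (f w))).
Proof. by rewrite /pnorm eqxx. Qed.

Lemma pnormE p f : p != 0 -> (forall w, 0 < f w) ->
  pnorm p f = expR (p^-1 * ln (expect (fun w => expR (p * ln (f w))))).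
Proof.
move=> p0 f0; rewrite /pnorm (negPf p0).
have -> : (fun w => f w `^ p) = fun w => expR (p * ln (f w)).
  by apply/funext => w; rewrite /powR gt_eqF.
by rewrite /powR gt_eqF //; apply: expect_gt0 => w; exact: expR_gt0.
Qed.

Lemma pnorm_gt0 p f : (forall w, 0 < f w) -> 0 < pnorm p f.
Proof.
move=> f0; have [->|p0] := eqVneq p 0; first by rewrite pnorm0E expR_gt0.
by rewrite pnormE // expR_gt0.
Qed.

Lemma expect_expR_gt0 (l : X -> R) : 0 < expect (fun w => expR (l w)).
Proof. by apply: expect_gt0 => w; exact: expR_gt0. Qed.

Lemma pnormZ p c f : 0 < c -> (forall w, 0 < f w) ->
  pnorm p (fun w => c * f w) = c * pnorm p f.
Proof.
move=> c0 f0; have lncf w : ln (c * f w) = ln c + ln (f w) by rewrite lnM ?posrE.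
have [->|p0] := eqVneq p 0.
  rewrite !pnorm0E (_ : (fun w => ln (c * f w)) = fun w => ln c + ln (f w)).
    by rewrite expectD expect_cst expRD lnK.
  exact/funext.
rewrite !pnormE // => [|w]; last by rewrite mulr_gt0.
have -> : (fun w => expR (p * ln (c * f w))) =
          fun w => expR (p * ln c) * expR (p * ln (f w)).
  by apply/funext => w; rewrite lncf mulrDr expRD.
rewrite expectZ lnM ?posrE ?expR_gt0 ?expect_expR_gt0 // expRK mulrDr expRD.
by rewrite mulKf // lnK.
Qed.

Lemma pnorm_cst p c : 0 < c -> pnorm p (fun _ : X => c) = c.
Proof.
move=> c0; have [->|p0] := eqVneq p 0; first by rewrite pnorm0E expect_cst lnK.
by rewrite pnormE // expect_cst expRK mulKf // lnK.
Qed.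

(** The logarithm of [f] after scaling to norm 1: dividing out the norm turns the
    later estimates into pointwise ones integrated against a constraint. *)
Lemma pnorm_normalize p f : (forall w, 0 < f w) ->
  exists u : X -> R, [/\ forall w, f w = pnorm p f * expR (u w),
    p = 0 -> expect u = 0 & p != 0 -> expect (fun w => expR (p * u w)) = 1].
Proof.
move=> f0; have N0 := pnorm_gt0 p f0.
exists (fun w => - ln (pnorm p f) + ln (f w)); split => [w|p0|p0].
- by rewrite expRD expRN !lnK ?posrE // mulVKf // gt_eqF.
- by rewrite expectD expect_cst p0 pnorm0E expRK addNr.
have -> : (fun w => expR (p * (- ln (pnorm p f) + ln (f w)))) =
    fun w => expR (- (p * ln (pnorm p f))) * expR (p * ln (f w)).
  by apply/funext => w; rewrite -expRD; congr expR; ring.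
rewrite expectZ pnormE // expRK mulVKf // expRN lnK ?posrE ?expect_expR_gt0 //.
by rewrite mulVf // gt_eqF // expect_expR_gt0.
Qed.

(** The reverse Hoelder inequality with its equality case: the density
    D = (F / ||F||_p)^(p-1) supports the concave functional ||.||_p at [F].
    With x = f ||F||_p / (F ||f||_p), D f is proportional to (F / ||F||_p)^p x
    and x is bounded below by [box_cox_le] (by 1 + ln x if p = 0). *)
Lemma pnorm_supporting_functional p F : p < 1 -> (forall w, 0 < F w) ->
  exists D : X -> R, [/\ forall w, 0 <= D w,
    expect (fun w => D w * F w) = pnorm p F &
    forall f, (forall w, 0 < f w) -> pnorm p f <= expect (fun w => D w * f w)].
Proof.
move=> p1 F0; have N0 := pnorm_gt0 p F0.
have [u [Fu u0 up]] := pnorm_normalize p F0.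
exists (fun w => expR ((p - 1) * u w)); split => [w||f f0]; first exact: expR_ge0.
  have -> : (fun w => expR ((p - 1) * u w) * F w) =
      fun w => pnorm p F * expR (p * u w).
    by apply/funext => w; rewrite Fu mulrCA -expRD; congr (_ * expR _); ring.
  rewrite expectZ; have [p0|/up ->] := eqVneq p 0; last by rewrite mulr1.
  rewrite (_ : (fun _ => _) = fun=> 1) ?expect_cst ?mulr1 //.
  by apply/funext => w; rewrite p0 mul0r expR0.
have n0 := pnorm_gt0 p f0; have [v [fv v0 vp]] := pnorm_normalize p f0.
have -> : (fun w => expR ((p - 1) * u w) * f w) =
    fun w => pnorm p f * (expR (p * u w) * expR (v w - u w)).
  by apply/funext => w; rewrite fv mulrCA -!expRD; congr (_ * expR _); ring.
rewrite expectZ ler_peMr ?(ltW n0) //.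
have [p0|p0] := eqVneq p 0.
  have <- : expect (fun w => 1 + 1 * (v w - u w)) = 1.
    by rewrite expect_lin u0 // v0 // expect_cst subrr mulr0 addr0.
  apply: le_expect => w; rewrite p0 mul0r expR0 !mul1r.
  exact: expR_ge1Dx.
have <- : expect (fun w => expR (p * u w) +
    p^-1 * (expR (p * v w) - expR (p * u w))) = 1.
  by rewrite expect_lin up // vp // subrr mulr0 addr0.
apply: le_expect => w.
have -> : expR (p * v w) = expR (p * u w) * expR (p * (v w - u w)).
  by rewrite -expRD; congr expR; ring.
rewrite -[X in _ - X]mulr1 -mulrBr mulrCA [p^-1 * _]mulrC -[X in X + _]mulr1 -mulrDr.
by rewrite ler_pM2l ?expR_gt0 // -lerBrDl box_cox_le.
Qed.

Lemma le_pnorm p f g : p < 1 -> (forall w, 0 < f w) -> (forall w, f w <= g w) ->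
  pnorm p f <= pnorm p g.
Proof.
move=> p1 f0 fg; have g0 w : 0 < g w by exact: lt_le_trans (fg w).
have [D [D0 <- H]] := pnorm_supporting_functional p1 g0.
by apply: le_trans (H f f0) _; apply: le_expect => w; rewrite ler_wpM2l.
Qed.

(** Every summand is bounded by the functional supporting the norm at the sum. *)
Lemma pnorm_superadditive (I : finType) p (a : I -> R) (h : I -> X -> R) :
  p < 1 -> (forall i, 0 <= a i) -> (forall i w, 0 < h i w) ->
  (forall w, 0 < \sum_i a i * h i w) ->
  \sum_i a i * pnorm p (h i) <= pnorm p (fun w => \sum_i a i * h i w).
Proof.
move=> p1 a0 h0 F0; have [D [D0 <- H]] := pnorm_supporting_functional p1 F0.
apply: (@le_trans _ _ (\sum_i a i * expect (fun w => D w * h i w))).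
  by apply: ler_sum => i _; rewrite ler_wpM2l // H.
rewrite /expect; under eq_bigr do rewrite mulr_sumr.
rewrite exchange_big /=; apply: ler_sum => w _; rewrite !mulr_sumr.
by rewrite le_eqVlt; apply/orP; left; apply/eqP/eq_bigr => i _; ring.
Qed.

End PowerMeans.

(** * The simple semigroup *)

Section SimpleCase.
Variable R : realType.
Implicit Type X : finProb R.

Lemma is_derive_expect X (g : X -> R -> R) (dg : X -> R) (r : R) :
  (forall w, is_derive r 1 (g w) (dg w)) ->
  is_derive r 1 (fun s => expect (fun w => g w s)) (expect dg).
Proof.
move=> Dg.
have -> : (fun s => expect (fun w => g w s)) = \sum_w (fp_mass w \*: g w).
  by apply/funext => s; rewrite fct_sumE.
rewrite /expect; elim/big_ind2 : _ => [|u1 v1 u2 v2 D1 D2|w _].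
- exact: is_derive_cst.
- exact: is_deriveD.
- exact: is_deriveZ.
Qed.

(** The limit of r^-1 ln E exp (r l) as r decreases to 0 is E l, since the
    quotient is at most E (l exp (r l)), which is continuous in r. *)
Lemma le_expect_of_log_mgf X (l : X -> R) (b d : R) : 0 < d ->
  (forall r, 0 < r < d -> r * b <= ln (expect (fun w => expR (r * l w)))) ->
  b <= expect l.
Proof.
move=> d0 H; pose G r := expect (fun w => l w * expR (r * l w)).
have bG r : 0 < r < d -> b <= G r.
  move=> rd; have /andP[r0 _] := rd.
  rewrite -(ler_pM2l r0) (le_trans (H r rd)) //.
  set M := expect _; have M0 : 0 < M by exact: expect_expR_gt0.
  apply: (@le_trans _ _ (M - 1)).
    have : -1 < M - 1 by lra.
    by move=> /le_ln1Dx; rewrite addrC subrK.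
  rewrite -expectZ lerBlDr -[X in _ + X](expect_cst X) -expectD.
  apply: le_expect => w; rewrite mulrA.
  have := expR_ge1Dx (- (r * l w)).
  rewrite -(ler_pM2l (expR_gt0 (r * l w))) -expRD subrr expR0; lra.
have G0 : G 0 = expect l.
  by congr expect; apply/funext => w; rewrite mul0r expR0 mulr1.
rewrite -G0.
have cG : (G x @[x --> 0^'+] --> G 0)%classic.
  apply: cvg_at_right_filter.
  have : derivable G 0 1.
    have [] // : is_derive (0 : R) 1 G (expect (fun w => l w * l w)).
    apply: is_derive_expect => w.
    apply: is_derive_eq; rewrite /GRing.scale /= mul0r expR0; ring.
  by move/derivable1_diffP/differentiable_continuous.
rewrite -(cvg_lim _ cG) //; apply: limr_ge; first by apply/cvg_ex; exists (G 0).
near=> x; apply: bG; apply/andP; split; near: x; [exact: nbhs_right_gt|exact: nbhs_right_lt].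
Unshelve. all: by end_near.
Qed.

Lemma simple_semigroup_gt0 X (t : R) (f : X -> R) : 0 <= t ->
  (forall w, 0 < f w) -> forall w, 0 < simple_semigroup t f w.
Proof.
move=> t0 f0 w; rewrite /simple_semigroup ltr_wpDr //.
  by rewrite mulr_ge0 ?(ltW (expect_gt0 f0)) // subr_ge0 -expR0 ler_expR oppr_le0.
by rewrite mulr_gt0 ?expR_gt0.
Qed.

(** Monotonicity of r |-> ||T_(theta r) f||_r away from r = 0.  The two bounds on
    [kappa] make [pointwise_entropy_bound] available at every exponent. *)
Lemma simple_flow X (f : X -> R) (p q : R) (theta kappa : R -> R) :
  (forall w, 0 < f w) -> expect f = 1 -> q <= p -> p < 1 ->
  (forall r, q <= r <= p -> r != 0) -> theta p = 0 ->
  (forall r, q <= r <= p -> [/\ is_derive r 1 theta (- kappa r), 0 <= theta r,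
     1 <= kappa r * (2 - r) & 1 <= kappa r * ((1 - r) * (2 - r))]) ->
  pnorm p f <= pnorm q (simple_semigroup (theta q) f).
Proof.
move=> f0 f1 qp p1 rn0 thp Hth.
pose g r := simple_semigroup (theta r) f.
have g0 r : q <= r <= p -> forall w, 0 < g r w.
  by case/Hth => _ th0 _ _; apply: simple_semigroup_gt0.
pose M r := expect (fun w => expR (r * ln (g r w))).
have M0 r : 0 < M r by exact: expect_expR_gt0.
pose W r := r^-1 * ln (M r).
have pn r : q <= r <= p -> pnorm r (g r) = expR (W r).
  by move=> rqp; rewrite pnormE ?rn0 //; exact: g0.
have Ep : pnorm p f = expR (W p).
  transitivity (pnorm p (g p)); last by apply: pn; rewrite qp lexx.
  by congr (pnorm p _); rewrite /g thp simple_semigroup0.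
have Eq : pnorm q (simple_semigroup (theta q) f) = expR (W q).
  by apply: pn; rewrite lexx qp.
rewrite Ep Eq ler_expR -lerN2.
pose dM r := expect (fun w => expR (r * ln (g r w)) *
  (ln (g r w) + r * (kappa r * (g r w - 1) / g r w))).
apply: (is_derive_ge0_le qp (F := fun r => - W r)
  (dF := fun r => r^-1 ^+ 2 * ln (M r) - r^-1 * (dM r / M r))) => r rqp.
  have [Dth _ _ _] := Hth r rqp.
  have r0 := rn0 r rqp.
  have Dg w : is_derive r 1 (fun s => g s w) (kappa r * (g r w - 1)).
    rewrite /g /simple_semigroup f1.
    apply: is_derive_eq; rewrite /GRing.scale /=; ring.
  have Dl w : is_derive r 1 (fun s => ln (g s w)) (kappa r * (g r w - 1) / g r w).
    have Dln := is_derive1_ln (g0 r rqp w).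
    by rewrite mulrC; exact: is_derive1_comp.
  have DM : is_derive r 1 M (dM r).
    apply: is_derive_expect => w; apply: is_derive_eq; rewrite /GRing.scale /=; ring.
  have DlM : is_derive r 1 (fun s => ln (M s)) (dM r / M r).
    have Dln := is_derive1_ln (M0 r).
    by rewrite mulrC; exact: is_derive1_comp.
  have DV : is_derive r 1 (fun s : R => s^-1) (- r^-1 ^+ 2).
    apply: (is_derive_eq (@is_deriveV R id r 1 1 r0 _)).
    by rewrite /GRing.scale /= mulr1 exprVn.
  apply: is_derive_eq; rewrite /GRing.scale /=; ring.
have [_ _ k1 k2] := Hth r rqp.
have r1 : r < 1 by case/andP: rqp => _ /le_lt_trans; apply.
have r0 := rn0 r rqp.
have Mln : M r - 1 <= M r * ln (M r) by exact: x_ln_x_ge.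
(* As E g = 1, adding a multiple of g - 1 changes no expectation but makes
   the inequality true pointwise. *)
have rdM : r * dM r <= M r - 1.
  have Eg : expect (g r) = 1 by rewrite /g /simple_semigroup expect_affine f1; ring.
  suff : r * dM r + 1 <= M r + kappa r * r ^+ 2 * (expect (g r) - expect (fun _ : X => 1)).
    by rewrite Eg expect_cst subrr mulr0 addr0 lerBrDr.
  rewrite -expect_lin -expect_affine; apply: le_expect => w.
  have gw := g0 r rqp w.
  have := pointwise_entropy_bound (ln (g r w)) r1 k1 k2.
  have -> : expR ((r - 1) * ln (g r w)) = expR (r * ln (g r w)) / g r w.
    by rewrite mulrBl mul1r expRD expRN lnK.
  rewrite [X in expR _ / g r w - expR _ + X]lnK ?posrE // -subr_ge0 => H.
  rewrite -subr_ge0; apply: le_trans H _; rewrite le_eqVlt; apply/orP; left; apply/eqP.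
  move: (g r w) gw => G /gt_eqF G0; move: (kappa r) (ln _) (expR _) => k y e.
  by field; rewrite G0.
have sgn (m dm : R) : 0 < m -> r * dm <= m - 1 -> m - 1 <= m * ln m ->
    0 <= r^-1 ^+ 2 * ln m - r^-1 * (dm / m); last exact: sgn.
move=> m0 rdm mln.
have -> : r^-1 ^+ 2 * ln m - r^-1 * (dm / m) = r^-1 ^+ 2 * m^-1 * (m * ln m - r * dm).
  by field; rewrite r0 gt_eqF.
rewrite mulr_ge0 ?subr_ge0 ?(le_trans rdm) //.
by rewrite mulr_ge0 ?sqr_ge0 // invr_ge0 ltW.
Qed.

End SimpleCase.

Section SimpleTheorem.
Variable R : realType.
Implicit Type X : finProb R.

Lemma simple_semigroupZ X (t c : R) (f : X -> R) (w : X) :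
  simple_semigroup t (fun x => c * f x) w = c * simple_semigroup t f w.
Proof. by rewrite /simple_semigroup expectZ; ring. Qed.

(** Reduction of [simple_flow] to a reference clock: scaling gives E f = 1, and the
    spare time t - theta q is spread linearly over [q, p], which only
    increases the speed. *)
Lemma simple_flow_time X (f : X -> R) (p q t : R) (theta kappa : R -> R) :
  (forall w, 0 < f w) -> q < p -> p < 1 ->
  (forall r, q <= r <= p -> r != 0) -> theta p = 0 -> theta q <= t ->
  (forall r, q <= r <= p -> [/\ is_derive r 1 theta (- kappa r),
     1 <= kappa r * (2 - r) & 1 <= kappa r * ((1 - r) * (2 - r))]) ->
  pnorm p f <= pnorm q (simple_semigroup t f).
Proof.
move=> f0 qp p1 rn0 thp tht Hth.
have kappa0 r : q <= r <= p -> 0 <= kappa r.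
  move=> rqp; have [_ k1 _] := Hth r rqp.
  have r2 : 0 < 2 - r by case/andP: rqp => _ rp; lra.
  by rewrite -(pmulr_lge0 _ r2); lra.
have E0 : 0 < expect f by exact: expect_gt0.
pose h w := (expect f)^-1 * f w.
have h0 w : 0 < h w by rewrite mulr_gt0 ?invr_gt0.
have fh : f = fun w => expect f * h w.
  by apply/funext => w; rewrite /h mulrA mulfV ?mul1r // gt_eqF.
have Eh : expect h = 1 by rewrite expectZ mulVf // gt_eqF.
have pq0 : 0 < p - q by rewrite subr_gt0.
pose c := (t - theta q) / (p - q).
have c0 : 0 <= c by rewrite divr_ge0 ?subr_ge0 // ltW.
pose theta' r := theta r + c * (p - r).
have -> : t = theta' q by rewrite /theta' /c divfK ?gt_eqF // addrC subrK.
have th'0 r : q <= r <= p -> 0 <= theta' r.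
  case/andP=> qr rp; apply: addr_ge0; last by rewrite (mulr_ge0 c0) // subr_ge0.
  suff : - theta r <= - theta p by rewrite thp oppr0 oppr_le0.
  have inq s : r <= s <= p -> q <= s <= p.
    by case/andP=> rs sp; rewrite sp (le_trans qr).
  apply: (is_derive_ge0_le rp (F := fun s => - theta s) (dF := kappa)) => s.
    move=> /inq/Hth[D _ _]; apply: is_derive_eq; exact: opprK.
  by move=> /inq; exact: kappa0.
have T0 : 0 <= theta' q by apply: th'0; rewrite lexx ltW.
have -> : simple_semigroup (theta' q) f =
    fun w => expect f * simple_semigroup (theta' q) h w.
  by apply/funext => w; rewrite {1}fh simple_semigroupZ.
rewrite {1}fh (pnormZ p E0 h0) (pnormZ q E0 (simple_semigroup_gt0 T0 h0)).
rewrite (ler_pM2l E0).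
apply: (@simple_flow R X h p q theta' (fun r => kappa r + c)) => //.
- exact: ltW.
- by rewrite /theta' thp subrr mulr0 addr0.
move=> r rqp; have [D k1 k2] := Hth r rqp.
have rp : 0 < 1 - r by case/andP: rqp => _ rp; lra.
have r2 : 0 < 2 - r by lra.
split; last 2 first.
- by rewrite mulrDl (le_trans k1) // lerDl (mulr_ge0 c0) // ltW.
- by rewrite mulrDl (le_trans k2) // lerDl (mulr_ge0 c0) // ltW // mulr_gt0.
- by apply: is_derive_eq; rewrite /GRing.scale /=; ring.
exact: th'0.
Qed.

Lemma simple_rhc_neg X (f : X -> R) (p q t : R) : (forall w, 0 < f w) ->
  q < p -> p < 0 -> ln (2 - q) - ln (2 - p) <= t ->
  pnorm p f <= pnorm q (simple_semigroup t f).
Proof.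
move=> f0 qp p0 tpq.
apply: (@simple_flow_time X f p q t (fun r => ln (2 - r) - ln (2 - p))
  (fun r => (2 - r)^-1)) => //.
- lra.
- by move=> r /andP[_ rp]; rewrite lt_eqF //; lra.
- by rewrite subrr.
move=> r /andP[qr rp]; have r2 : 0 < 2 - r by lra.
split.
- have Dln := is_derive1_ln r2.
  apply: is_derive_eq; rewrite /GRing.scale /=; ring.
- by rewrite mulVf // gt_eqF.
- by rewrite mulrCA mulVf ?gt_eqF //; lra.
Qed.

Lemma simple_rhc_pos X (f : X -> R) (p q t : R) : (forall w, 0 < f w) ->
  0 < q -> q < p -> p < 1 ->
  ln (1 - q) - ln (2 - q) - (ln (1 - p) - ln (2 - p)) <= t ->
  pnorm p f <= pnorm q (simple_semigroup t f).
Proof.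
move=> f0 q0 qp p1 tpq.
apply: (@simple_flow_time X f p q t
  (fun r => ln (1 - r) - ln (2 - r) - (ln (1 - p) - ln (2 - p)))
  (fun r => ((1 - r) * (2 - r))^-1)) => //.
- by move=> r /andP[qr _]; rewrite gt_eqF //; lra.
- by rewrite subrr.
move=> r /andP[qr rp]; have r1 : 0 < 1 - r by lra.
have r2 : 0 < 2 - r by lra.
split.
- have Dln1 := is_derive1_ln r1; have Dln2 := is_derive1_ln r2.
  by apply: is_derive_eq; rewrite /GRing.scale /=; field; rewrite !gt_eqF.
- by rewrite invfM divfK ?gt_eqF // invf_ge1 //; lra.
- by rewrite mulVf // mulf_neq0 // gt_eqF.
Qed.

(** At p = 0 the norms of exponent - r < 0 are compared first, the threshold for
    them being lower, and r decreases to 0. *)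
Lemma simple_rhc_nonpos X (f : X -> R) (p q t : R) : (forall w, 0 < f w) ->
  0 <= t -> q < p -> p <= 0 -> ln (2 - q) - ln (2 - p) <= t ->
  pnorm p f <= pnorm q (simple_semigroup t f).
Proof.
move=> f0 t0 qp; rewrite le_eqVlt => /predU1P[p0|p0]; last exact: simple_rhc_neg.
subst p => tq.
have g0 := simple_semigroup_gt0 t0 f0.
set C := pnorm q _; have C0 : 0 < C by exact: pnorm_gt0.
rewrite pnorm0E -[leRHS]lnK // ler_expR.
suff : - ln C <= expect (fun w => -1 * ln (f w)) by rewrite expectZ mulN1r lerN2.
apply: (@le_expect_of_log_mgf R X _ _ (- q)) => [|r /andP[r0 rq]]; first lra.
have : pnorm (- r) f <= C.
  apply: simple_rhc_neg => //; [lra|lra|].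
  apply: le_trans tq; rewrite lerD2l lerN2 ler_ln ?posrE; lra.
rewrite pnormE // ?oppr_eq0 ?gt_eqF // -[leRHS]lnK // ler_expR invrN mulNr lerNl.
rewrite mulrC ler_pdivlMr // mulrC.
rewrite (_ : (fun w => expR (- r * ln (f w))) =
  fun w => expR (r * (-1 * ln (f w)))) //.
by apply/funext => w; congr expR; ring.
Qed.

(** At q = 0 the exponents r > 0 are reached before time [t], and r decreases to 0. *)
Lemma simple_rhc_nonneg X (f : X -> R) (p q t : R) : (forall w, 0 < f w) ->
  0 <= t -> 0 <= q -> q < p -> p < 1 ->
  ln (1 - q) - ln (2 - q) - (ln (1 - p) - ln (2 - p)) <= t ->
  pnorm p f <= pnorm q (simple_semigroup t f).
Proof.
move=> f0 t0; rewrite le_eqVlt => /predU1P[q0|q0]; last exact: simple_rhc_pos.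
subst q => p0 p1 tp.
have g0 := simple_semigroup_gt0 t0 f0.
set C := pnorm p _; have C0 : 0 < C by exact: pnorm_gt0.
rewrite pnorm0E -[leLHS]lnK // ler_expR.
apply: (@le_expect_of_log_mgf R X _ _ p) => // r /andP[r0 rp].
have : C <= pnorm r (simple_semigroup t f).
  apply: simple_rhc_pos => //; apply: le_trans tp.
  rewrite lerD2r -!ln_div ?posrE; [|lra..].
  rewrite ler_ln ?posrE ?divr_gt0; [|lra..].
  by rewrite ler_pdivrMr ?subr0; lra.
rewrite pnormE // ?gt_eqF // -[leLHS]lnK // ler_expR.
by rewrite mulrC ler_pdivlMr // mulrC.
Qed.

End SimpleTheorem.

(** * Tensor products *)

Section Tensorization.
Variable R : realType.
Implicit Types X Y Z : finProb R.

Definition kernel_op X (K : X -> X -> R) (f : X -> R) : X -> R :=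
  fun x => \sum_y K x y * f y.

(** Reverse hypercontractivity in the form that is stable under products: the
    kernel is nonnegative and the operator preserves strict positivity. *)
Definition rhc_kernel X (K : X -> X -> R) (p q : R) : Prop :=
  [/\ forall x y, 0 <= K x y,
      forall f, (forall x, 0 < f x) -> forall x, 0 < kernel_op K f x &
      forall f, (forall x, 0 < f x) -> pnorm p f <= pnorm q (kernel_op K f)].

Section Product.
Variables (X Y Z : finProb R) (psi : Z * Y -> X).
Hypotheses (psi_bij : bijective psi)
  (psi_mass : forall z y, fp_mass (psi (z, y)) = fp_mass z * fp_mass y).

Lemma expect_product (f : X -> R) :
  expect f = expect (fun z => expect (fun y => f (psi (z, y)))).
Proof.
rewrite /expect (reindex psi) /=; last exact: onW_bij.
under [RHS]eq_bigr do rewrite mulr_sumr.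
rewrite pair_bigA; apply: eq_bigr => -[z y] _ /=.
by rewrite psi_mass mulrA.
Qed.

Lemma pnorm_product p (f : X -> R) : (forall x, 0 < f x) ->
  pnorm p f = pnorm p (fun z => pnorm p (fun y => f (psi (z, y)))).
Proof.
move=> f0; have fz0 z : 0 < pnorm p (fun y => f (psi (z, y))) by exact: pnorm_gt0.
have [p0|p0] := eqVneq p 0.
  subst p; rewrite !pnorm0E expect_product; congr (expR (expect _)).
  by apply/funext => z; rewrite pnorm0E expRK.
rewrite [in LHS]pnormE // [in RHS]pnormE // expect_product.
congr (expR (_ * ln (expect _))); apply/funext => z.
by rewrite pnormE // expRK mulVKf // lnK ?posrE ?expect_expR_gt0.
Qed.

(** Taking norms over [Y] first, G z = ||f (z, .)||_p satisfies
    ||f||_p = ||G||_p <= ||K_Z G||_q.  By superadditivity K_Z G is at most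
    the p-norm over [Y] of K_Z f, hence at most the q-norm over [Y] of
    K_Y K_Z f. *)
Lemma rhc_kernel_product (KX : X -> X -> R) (KY : Y -> Y -> R) (KZ : Z -> Z -> R)
    (p q : R) : p < 1 -> q < 1 ->
  (forall a b, KX (psi a) (psi b) = KZ a.1 b.1 * KY a.2 b.2) ->
  rhc_kernel KY p q -> rhc_kernel KZ p q -> rhc_kernel KX p q.
Proof.
move=> p1 q1 KXE [KY0 KYpos KYle] [KZ0 KZpos KZle].
have [phi phiK psiK] := psi_bij.
have KE f z y : kernel_op KX f (psi (z, y)) =
    kernel_op KY (fun y' => kernel_op KZ (fun z' => f (psi (z', y'))) z) y.
  rewrite /kernel_op (reindex psi) /=; last exact: onW_bij.
  under [RHS]eq_bigr do rewrite mulr_sumr.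
  rewrite exchange_big pair_bigA; apply: eq_bigr => -[z' y'] _ /=.
  by rewrite KXE /= mulrA [KZ _ _ * _]mulrC.
have Kpos f : (forall x, 0 < f x) -> forall x, 0 < kernel_op KX f x.
  move=> f0 x; rewrite -(psiK x); case: (phi x) => z y.
  by rewrite KE; apply: KYpos => y'; apply: KZpos => z'.
split=> [x x'||f f0]; [|exact: Kpos|].
  by rewrite -[x]psiK -[x']psiK KXE mulr_ge0.
rewrite (pnorm_product p f0) (pnorm_product q (Kpos f f0)).
pose G z := pnorm p (fun y => f (psi (z, y))).
have G0 z : 0 < G z by exact: pnorm_gt0.
apply: (le_trans (KZle G G0)); apply: (le_pnorm q1) => [|z]; first exact: (KZpos G G0).
have F0 y : 0 < kernel_op KZ (fun z' => f (psi (z', y))) z by exact: KZpos.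
rewrite (eq_pnorm q (KE f z)); apply: le_trans (KYle _ F0).
by apply: (@pnorm_superadditive R Y Z p (KZ z) (fun z' y => f (psi (z', y)))).
Qed.

End Product.

(** Surjectivity comes from counting, which avoids rebuilding a dependent function
    from its pieces by casts. *)
Lemma dffun_split_bij n (T : 'I_n.+1 -> finType) :
  bijective (fun x : {dffun forall i, T i} =>
    (x ord0, [ffun j => x (lift ord0 j)] : {dffun forall j, T (lift ord0 j)})).
Proof.
apply: inj_card_bij => [x x' [E0 /ffunP E]|].
  apply/ffunP => i; have [j ->|->] := unliftP ord0 i; last exact: E0.
  by have := E j; rewrite !ffunE.
rewrite card_prod !card_dep_ffun !foldrE !big_image /=.
by rewrite big_ord_recl.
Qed.

Definition simple_kernel X (t : R) (x y : X) : R :=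
  simple_semigroup t (fun z => (z == y)%:R) x.

Lemma simple_kernelE X (t : R) (x y : X) :
  simple_kernel t x y = expR (- t) * (x == y)%:R + (1 - expR (- t)) * fp_mass y.
Proof.
rewrite /simple_kernel /simple_semigroup /expect (bigD1 y) //= eqxx mulr1.
by rewrite big1 ?addr0 // => z /negPf ->; rewrite mulr0.
Qed.

Lemma kernel_op_simple X (t : R) (f : X -> R) :
  kernel_op (simple_kernel t) f = simple_semigroup t f.
Proof.
apply/funext => x; rewrite /kernel_op /simple_semigroup /expect.
under eq_bigr do rewrite simple_kernelE mulrDl -!mulrA.
rewrite big_split /= -!mulr_sumr; congr (_ * _ + _).
rewrite (bigD1 x) //= eqxx mul1r big1 ?addr0 // => z.
by rewrite eq_sym => /negPf ->; rewrite mul0r.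
Qed.

Lemma simple_kernel_ge0 X (t : R) (x y : X) : 0 <= t -> 0 <= simple_kernel t x y.
Proof.
move=> t0; rewrite simple_kernelE addr_ge0 // mulr_ge0 ?expR_ge0 //.
  by rewrite subr_ge0 -expR0 ler_expR oppr_le0.
by rewrite ltW // fp_mass_gt0.
Qed.

Lemma rhc_tensor_kernel (p q t : R) : p < 1 -> q < 1 -> 0 <= t ->
  (forall X (f : X -> R), (forall w, 0 < f w) ->
     pnorm p f <= pnorm q (simple_semigroup t f)) ->
  forall n (X : 'I_n -> finProb R),
  rhc_kernel (fun x y : prod_finProb X => \prod_i simple_kernel t (x i) (y i)) p q.
Proof.
move=> p1 q1 t0 H; elim=> [|n IHn] X.
  have xE (x y : prod_finProb X) : x = y by apply/ffunP => -[].
  have fE (f : prod_finProb X -> R) : f = fun=> expect f.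
    apply/funext => x; rewrite -[LHS](expect_cst (prod_finProb X)).
    by congr expect; apply/funext => y; rewrite (xE x y).
  have KE (f : prod_finProb X -> R) : kernel_op
      (fun x y : prod_finProb X => \prod_i simple_kernel t (x i) (y i)) f = f.
    rewrite [RHS]fE; apply/funext => x; apply: eq_bigr => y _.
    by rewrite /= /prod_mass !big_ord0.
  split=> [x y|f f0 x|f f0]; [by rewrite big_ord0|by rewrite KE|].
  by rewrite KE (fE f) !pnorm_cst ?expect_gt0.
have [psi phiK psiK] := dffun_split_bij (fun i => fp_space (X i)).
have psi0 z y : psi (z, y) ord0 = z by have := psiK (z, y); case.
have psiS z y j : psi (z, y) (lift ord0 j) = y j.
  by have [_ /ffunP/(_ j)] := psiK (z, y); rewrite ffunE.
apply: (@rhc_kernel_product (prod_finProb X)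
  (prod_finProb (fun j => X (lift ord0 j))) (X ord0) psi _ _ _
  (fun x y => \prod_j simple_kernel t (x j) (y j)) (simple_kernel t) p q p1 q1 _ (IHn _)).
- by eexists; [exact: psiK|exact: phiK].
- move=> z y; rewrite /= /prod_mass big_ord_recl psi0; congr (_ * _).
  by apply: eq_bigr => j _; rewrite psiS.
- move=> [z y] [z' y'] /=; rewrite big_ord_recl !psi0; congr (_ * _).
  by apply: eq_bigr => j _; rewrite !psiS.
split=> [x y|f f0|f f0]; first exact: simple_kernel_ge0.
  by rewrite kernel_op_simple; exact: simple_semigroup_gt0.
by rewrite kernel_op_simple; exact: H.
Qed.

Lemma rhc_simple_or_tensor X (T : R -> (X -> R) -> X -> R) (p q t : R) :
  p < 1 -> q < 1 -> 0 <= t ->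
  (forall Y (f : Y -> R), (forall w, 0 < f w) ->
     pnorm p f <= pnorm q (simple_semigroup t f)) ->
  simple_or_tensor T -> forall f, (forall w, 0 < f w) -> pnorm p f <= pnorm q (T t f).
Proof.
move=> p1 q1 t0 H; case=> [Y|n Y _] f f0; first exact: H.
have [_ _ K] := rhc_tensor_kernel p1 q1 t0 H Y.
have -> : tensor_semigroup (fun i => @simple_semigroup R (Y i)) t f =
    kernel_op (fun x y : prod_finProb Y => \prod_i simple_kernel t (x i) (y i)) f.
  by apply/funext => x; apply: eq_bigr => y _; rewrite mulrC.
exact: K.
Qed.

End Tensorization.

Theorem theorem1p12 (R : realType) (X : finProb R)
    (T : R -> (X -> R) -> X -> R) (hT : simple_or_tensor T)
    (f : X -> R) (hf : forall w, 0 < f w) :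
  (forall p q t : R, q < p -> p <= 0 ->
     ln ((2 - q) / (2 - p)) <= t ->
     pnorm p f <= pnorm q (T t f)) /\
  (forall p q t : R, 0 <= q -> q < p -> p < 1 ->
     ln (((1 - q) * (2 - p)) / ((1 - p) * (2 - q))) <= t ->
     pnorm p f <= pnorm q (T t f)).
Proof.
split=> p q t.
  move=> qp p0 tpq; have p2 : 0 < 2 - p by lra.
  have q2 : 0 < 2 - q by lra.
  have t0 : 0 <= t by apply: le_trans tpq; rewrite ln_ge0 // ler_pdivlMr //; lra.
  apply: (rhc_simple_or_tensor _ _ t0 _ hT hf) => [||Y g g0]; [lra|lra|].
  by apply: (simple_rhc_nonpos g0 t0 qp p0); rewrite -ln_div.
move=> q0 qp p1 tpq; have p2 : 0 < 2 - p by lra.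
have q2 : 0 < 2 - q by lra.
have p1' : 0 < 1 - p by lra.
have q1' : 0 < 1 - q by lra.
have t0 : 0 <= t.
  by apply: le_trans tpq; rewrite ln_ge0 // ler_pdivlMr ?mulr_gt0 //; lra.
apply: (rhc_simple_or_tensor p1 _ t0 _ hT hf) => [|Y g g0]; first lra.
apply: (simple_rhc_nonneg g0 t0 q0 qp p1); apply: le_trans tpq.
by rewrite ln_div ?posrE ?mulr_gt0 // !lnM ?posrE //; lra.
Qed.
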